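(* For any $\eta\in\mathcal{P}$, let $y(\cdot,\eta)\in C^1(\mathcal{T};V_{2n})$ be the solution of the full Hamiltonian model $$\dot y(t,\eta)=J_{2n}\nabla_y\mathcal{H}(y(t,\eta),\eta),\quad t\in\mathcal{T},\qquad y(t_0,\eta)=y^0(\eta),$$ and let $z(\cdot,\eta)\in C^1(\mathcal{T};V_{2k})$ be the solution of the hyper-reduced model $$\dot z(t,\eta)=J_{2k}\nabla_z\mathcal{H}_{hr}(z(t,\eta),\eta),\quad t\in\mathcal{T},\qquad z(t_0,\eta)=A^\top y^0(\eta).$$ Let $\mathbb{P}=U(P^\top U)^{-1}P^\top$ be the DEIM projection. Assume that, for every $\eta\in\mathcal{P}$, the Jacobian $J_{\eta,h}$ of $h(\cdot,\eta)$ is Lipschitz continuous in the $2$-norm with constant $\mathcal{L}_h(\eta)$, i.e. $\|J_{\eta,h}(y_1)-J_{\eta,h}(y_2)\|_2\le \mathcal{L}_h(\eta)\|y_1-y_2\|$ for all $y_1,y_2\in V_{2n}$. Then $$\|y-Az\|^2_{L^2(\mathcal{T}\times\mathcal{P})}\le C_1(T)\,\|y-AA^\top y\|^2_{L^2(\mathcal{T}\times\mathcal{P})}+C_2(T)\,\|(I-\mathbb{P})J_{\eta,h}(AA^\top y)A\|^2_{L^2(\mathcal{T}\times\mathcal{P})},$$ where, with $\Delta\mathcal{T}:=T-t_0$, $$C_1(T):=\Delta\mathcal{T}\max_{\eta\in\mathcal{P}}\big(C_\eta(T)\alpha^2(\eta)\big)+1,\qquad C_2(T):=\Delta\mathcal{T}\,\|v\|^2\max_{\eta\in\mathcal{P}}C_\eta(T),$$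 $$C_\eta(T):=\begin{cases}\beta^{-1}(\eta)\big(e^{2\beta(\eta)(T-t_0)}-1\big), & \beta(\eta)\ne 0,\\ 2(T-t_0), & \beta(\eta)=0,\end{cases}$$ with $K(\eta):=J_{2n}L(\eta)$, $\alpha(\eta):=\|A^\top K(\eta)\|_2+\mathcal{L}_{\mathcal{N}}(\eta)$, where $\mathcal{L}_{\mathcal{N}}(\eta)$ is the Lipschitz constant of $\nabla\mathcal{N}(\cdot,\eta)$, $\beta(\eta):=\mu(K(\eta))+\mathcal{L}_h(\eta)\,\|(P^\top U)^{-1}\|_2\,\|v\|$, and $\mu(K):=\sup_{x\ne0}\frac{(x,Kx)}{(x,x)}$ is the logarithmic norm with respect to the $2$-norm.
   Context: $\|\cdot\|$ is the Euclidean vector norm, $\|\cdot\|_2$ the spectral matrix norm, $(\cdot,\cdot)$ the Euclidean inner product. $\mathcal{T}=(t_0,T]$; $\mathcal{P}\subset\mathbb{R}^p$ is a compact parameter set. $V_{2n}$ is the $2n$-dimensional phase space, a symplectic vector space identified with $\mathbb{R}^{2n}$; $V_{2k}$ is the reduced space, identified with $\mathbb{R}^{2k}$, $k\ll n$. $J_{2n}=\begin{pmatrix}0&I_n\\-I_n&0\end{pmatrix}$, and $J_{2k}$ is defined analogously. Hamiltonian: $\mathcal{H}(y,\eta)=\tfrac12y^\top L(\eta)y+y^\top f(\eta)+\mathcal{G}(\eta)+\mathcal{N}(y,\eta)$, with $L(\eta)\in\mathbb{R}^{2n\times2n}$ symmetric positive semi-definite, $f(\eta)\in\mathbb{R}^{2n}$,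 $\mathcal{G}(\eta)\in\mathbb{R}$ and $\mathcal{N}(\cdot,\eta)$ nonlinear. Standing assumption: for each $\eta$, $\nabla_y\mathcal{H}(\cdot,\eta)$ is Lipschitz continuous in the Euclidean norm (hence so is $\nabla\mathcal{N}(\cdot,\eta)$). Reduced basis: $A\in\mathbb{R}^{2n\times2k}$ satisfies $A^\top A=I_{2k}$ and $A^\top J_{2n}A=J_{2k}$ (consequently $A^\top J_{2n}=J_{2k}A^\top$). Decomposition: for some $d\in\mathbb{N}$ there are a constant vector $v\in\mathbb{R}^d$ and $h:V_{2n}\times\mathcal{P}\to\mathbb{R}^d$ such that $\mathcal{N}(Az,\eta)=v^\top h(Az,\eta)$ for all $z\in V_{2k}$, $\eta\in\mathcal{P}$; $J_{\eta,h}(\cdot)\in\mathbb{R}^{d\times2n}$ denotes the Jacobian of $h(\cdot,\eta)$. DEIM: $U\in\mathbb{R}^{d\times m}$ (the DEIM basis, obtained by proper orthogonal decomposition) has orthonormal columns, $P=[\mathbf{e}_{\beta(1)},\dots,\mathbf{e}_{\beta(m)}]\in\mathbb{R}^{d\times m}$ consists of unit vectors of $\mathbb{R}^d$ associated with distinct interpolation indices, and $P^\top U$ is nonsingular. Hyper-reduced Hamiltonian: $\mathcal{H}_{hr}(z,\eta)=\tfrac12z^\top A^\top L(\eta)Az+z^\top A^\top f(\eta)+\mathcal{G}(\eta)+v^\top\mathbb{P}h(Az,\eta)$. The $L^2(\mathcal{T}\times\mathcal{P})$ norms are $\big(\int_{\mathcal{P}}\int_{\mathcal{T}}\|\cdot\|^2\,dt\,d\eta\big)^{1/2}$,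 with the Euclidean norm for vector-valued and the spectral norm for matrix-valued functions; these norms and the maxima over $\mathcal{P}$ are implicitly assumed to be well defined. *)

(* Defs.v *)
From HB Require Import structures.
From mathcomp Require Import all_boot all_order all_algebra.
From mathcomp Require Import all_classical all_reals all_analysis.
From mathcomp Require Import measurable_realfun.

Set Implicit Arguments.
Unset Strict Implicit.
Unset Printing Implicit Defensive.

Import Order.TTheory GRing.Theory Num.Theory.
Import numFieldNormedType.Exports.

Local Open Scope classical_set_scope.
Local Open Scope ring_scope.

(* The library norm `|x| on matrices is the max norm, hence the Euclidean norm
   and the induced operator norm below. On a zero-dimensional space each of the
   suprema below is 0 (sup set0 = 0). *)
Definition dotp (R : realType) (n : nat) (x y : 'cV[R]_n) : R :=
  (x^T *m y) 0 0.

Definition norm2 (R : realType) (n : nat) (x : 'cV[R]_n) : R :=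
  Num.sqrt (dotp x x).

Definition specnorm (R : realType) (m n : nat) (M : 'M[R]_(m, n)) : R :=
  sup [set norm2 (M *m x) | x in [set x : 'cV[R]_n | norm2 x <= 1]].

Definition lognorm (R : realType) (n : nat) (K : 'M[R]_n) : R :=
  sup [set dotp x (K *m x) / dotp x x | x in [set x : 'cV[R]_n | x != 0]].

Definition lipschitz2 (R : realType) (m n : nat) (g : 'cV[R]_n -> 'cV[R]_m) :=
  exists C : R, forall x y, norm2 (g x - g y) <= C * norm2 (x - y).

(* Meaningful only when [lipschitz2 g]. *)
Definition lipschitz_const (R : realType) (m n : nat)
    (g : 'cV[R]_n -> 'cV[R]_m) : R :=
  sup [set norm2 (g u.1 - g u.2) / norm2 (u.1 - u.2) |
       u in [set u : 'cV[R]_n * 'cV[R]_n | u.1 != u.2]].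

Definition grad (R : realType) (n : nat) (F : 'cV[R]_n -> R) (x : 'cV[R]_n)
    : 'cV[R]_n :=
  \col_j 'D_(delta_mx j 0) F x.

(* Column-vector convention, i.e. rows indexed by the components of [h]; the
   library's [jacobian] acts on row vectors and is the transpose of this. *)
Definition jac (R : realType) (n d : nat) (h : 'cV[R]_n -> 'cV[R]_d)
    (x : 'cV[R]_n) : 'M[R]_(d, n) :=
  \matrix_(i, j) 'D_(delta_mx j 0) (fun u => h u i 0) x.

Definition sympJ (R : realType) (n : nat) : 'M[R]_(n + n) :=
  block_mx 0 1%:M (- 1%:M) 0.
Arguments sympJ {R}.

Definition hamiltonian (R : realType) (n : nat) (L : 'M[R]_(n + n))
    (f : 'cV[R]_(n + n)) (G : R) (N : 'cV[R]_(n + n) -> R)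
    (y : 'cV[R]_(n + n)) : R :=
  2^-1 * (y^T *m L *m y) 0 0 + (y^T *m f) 0 0 + G + N y.

Definition hyper_reduced_hamiltonian (R : realType) (n k d : nat)
    (A : 'M[R]_(n + n, k + k)) (L : 'M[R]_(n + n)) (f : 'cV[R]_(n + n)) (G : R)
    (v : 'cV[R]_d) (PP : 'M[R]_d) (h : 'cV[R]_(n + n) -> 'cV[R]_d)
    (z : 'cV[R]_(k + k)) : R :=
  2^-1 * (z^T *m A^T *m L *m A *m z) 0 0 + (z^T *m A^T *m f) 0 0 + G
  + (v^T *m PP *m h (A *m z)) 0 0.

Definition selection_mx (R : realType) (d m : nat) (idx : 'I_m -> 'I_d)
    : 'M[R]_(d, m) :=
  \matrix_(i, j) (i == idx j)%:R.
Arguments selection_mx {R d m}.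

Definition deim_proj (R : realType) (d m : nat) (U P : 'M[R]_(d, m))
    : 'M[R]_d :=
  U *m invmx (P^T *m U) *m P^T.

(* The derivative is relative to [D], hence one-sided at an endpoint of an
   interval belonging to it. *)
Definition has_deriv_within (R : realType) (n : nat) (D : set R)
    (u : R -> 'cV[R]_n) (t : R) (u' : 'cV[R]_n) : Prop :=
  (s - t)^-1 *: (u s - u t) @[s --> within D t^'] --> u'.

Definition C1_within (R : realType) (n : nat) (D : set R)
    (u : R -> 'cV[R]_n) : Prop :=
  exists2 du : R -> 'cV[R]_n, {within D, continuous du} &
    forall t, D t -> has_deriv_within D u t (du t).

(* The equation holds on the half-open interval ]t0, T]; continuity up to t0 is
   what ties the initial value to the trajectory. *)
Definition solves_ivp (R : realType) (n : nat) (t0 T : R)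
    (F : 'cV[R]_n -> 'cV[R]_n) (u0 : 'cV[R]_n) (u : R -> 'cV[R]_n) : Prop :=
  [/\ C1_within `]t0, T] u,
      {within `[t0, T], continuous u},
      forall t, t0 < t <= T -> has_deriv_within `]t0, T] u t (F (u t)) &
      u t0 = u0].

Definition has_maximum (R : realType) (S : set R) : Prop :=
  exists2 M, S M & ubound S M.

Definition growth_const (R : realType) (t0 T b : R) : R :=
  if b == 0 then 2 * (T - t0) else b^-1 * (expR (2 * b * (T - t0)) - 1).

(* Lebesgue measure on R^p is obtained on the Borel sets as an iterated product
   of the one-dimensional one, and then completed. *)
Definition borel_rV (R : realType) (p : nat) :=
  g_sigma_algebraType (@open 'rV[R]_p).

Definition rV_cons (R : realType) (p : nat)
    (x : borel_rV R p * measurableTypeR R) : borel_rV R p.+1 :=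
  row_mx (x.2 : R)%:M (x.1 : 'rV[R]_p).

Lemma measurable_rV_cons (R : realType) (p : nat) :
  measurable_fun setT (@rV_cons R p).
Proof.
apply: (@measurability _ _ (borel_rV R p * measurableTypeR R)%type
  (borel_rV R p.+1) setT (@rV_cons R p) (@open 'rV[R]_p.+1)) => //.
move=> _ [U oU <-]; rewrite setTI.
pose rect (q : 'rV[rat]_p * rat * nat) : set (borel_rV R p * measurableTypeR R)
  := ball (map_mx ratr q.1.1 : 'rV[R]_p) q.2.+1%:R^-1 `*`
     ball (ratr q.1.2 : R) q.2.+1%:R^-1.
have -> : @rV_cons R p @^-1` U =
  \bigcup_(q in [set q | rect q `<=` @rV_cons R p @^-1` U]) rect q.
  apply/seteqP; split=> [[w s] /= Ux|]; last first.
    by move=> x [q qU qx]; exact: qU.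
  have /nbhs_ballP[e /= e0 eU] := oU _ Ux.
  have [N _ /(_ N (leqnn _)) Ne] := near_infty_natSinv_lt (PosNum (divr_gt0 e0 (ltr0Sn R 1))).
  have N0 : 0 < N.+1%:R^-1 :> R by rewrite invr_gt0.
  have ratb (a : R) : {q : rat | ball (ratr q : R) N.+1%:R^-1 a}.
    apply: cid.
    have [q /itvP qa] := @rat_in_itvoo R a (a + N.+1%:R^-1) (ltr_pwDr N0 (lexx _)).
    exists q; rewrite /ball/= ger0_norm ?subr_ge0 ?qa// ltrBlDl.
    by rewrite qa.
  exists (\row_j sval (ratb (w 0 j)), sval (ratb s), N); last first.
    split => /=; last exact: (svalP (ratb s)).
    split=> // i j; rewrite !mxE ord1; exact: (svalP (ratb (w 0 j))).
  move=> [w' s'] [/= [_ ww'] ss']; apply: eU.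
  have split2 : N.+1%:R^-1 + N.+1%:R^-1 < e :> R.
    by rewrite [ltRHS]splitr ltrD.
  split=> // i j; apply: (le_ball (ltW split2)).
  case: (@split_ordP 1 p j) => j' ->.
    rewrite !(@row_mxEl _ 1 1 p) !mxE !ord1 eqxx !mulr1n.
    by apply: ball_triangle ss'; apply: ball_sym; exact: (svalP (ratb s)).
  rewrite !(@row_mxEr _ 1 1 p); have := ww' i j'; rewrite !mxE ord1.
  by apply: ball_triangle; apply: ball_sym; exact: (svalP (ratb (w 0 j'))).
rewrite bigcup_mkcond; apply: countable_bigcupT_measurable => // q.
case: ifPn => // _; apply: measurableX; last exact: measurable_ball.
by apply: sub_sigma_algebra; exact: ball_open.
Qed.

Section rV_cons_measure.
Variables (R : realType) (p : nat) (mu : {measure set (borel_rV R p) -> \bar R}).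

Definition rV_cons_measure : set (borel_rV R p.+1) -> \bar R :=
  pushforward (mu \x (@lebesgue_measure R))%E (@rV_cons R p).

Let mu_cons0 : rV_cons_measure set0 = 0%E.
Proof. by rewrite /rV_cons_measure /pushforward preimage_set0 measure0. Qed.

Let mu_cons_ge0 A : (0 <= rV_cons_measure A)%E.
Proof. by rewrite /rV_cons_measure /pushforward. Qed.

Let mu_cons_sigma_additive : semi_sigma_additive rV_cons_measure.
Proof.
exact: (@measure_semi_sigma_additive _ _ _
  (measure_function_pushforward__canonical__measure_function_Measure _
    (@measurable_rV_cons R p))).
Qed.

HB.instance Definition _ := isMeasure.Build _ _ _ rV_cons_measure
  mu_cons0 mu_cons_ge0 mu_cons_sigma_additive.

End rV_cons_measure.

Fixpoint borel_lebesgue_rV (R : realType) (p : nat)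
    : {measure set (borel_rV R p) -> \bar R} :=
  match p with
  | 0 => @dirac _ (borel_rV R 0) (0 : 'rV[R]_0) R
  | p'.+1 => rV_cons_measure (borel_lebesgue_rV R p')
  end.

Definition lebesgue_rV_type (R : realType) (p : nat) :=
  caratheodory_type (borel_lebesgue_rV R p)^*%mu.

Definition lebesgue_rV (R : realType) (p : nat)
    : {measure set (lebesgue_rV_type R p) -> \bar R} :=
  @completed_measure_extension _ _ _ (borel_lebesgue_rV R p).
Arguments lebesgue_rV : clear implicits.

(* In the two definitions below, [g t eta] stands for the pointwise (Euclidean
   or spectral) norm of the function of interest; [L2norm] takes values in
   [0, +oo], and [L2_measurable] says that the iterated integral defining it
   makes sense. *)
Definition L2norm (R : realType) (p : nat) (t0 T : R) (P : set 'rV[R]_p)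
    (g : R -> 'rV[R]_p -> R) : \bar R :=
  ((\int[lebesgue_rV R p]_(eta in P)
      \int[lebesgue_measure]_(t in `]t0, T]) ((g t eta) ^+ 2)%:E) `^ 2^-1)%E.

Definition L2_measurable (R : realType) (p : nat) (t0 T : R)
    (P : set 'rV[R]_p) (g : R -> 'rV[R]_p -> R) : Prop :=
  (forall eta, P eta -> measurable_fun `]t0, T] (g^~ eta)) /\
  measurable_fun (P : set (lebesgue_rV_type R p))
    (fun eta : lebesgue_rV_type R p =>
      \int[lebesgue_measure]_(t in `]t0, T]) ((g t eta) ^+ 2)%:E)%E.

(* Main.v *)
(* Write rho = y - A A^T y and e = A^T y - z. Then y - A z = rho + A e is an
   orthogonal sum, so |y - A z|^2 = |rho|^2 + |e|^2. Since A^T J_2n = J_2k A^T,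
   the equation for e splits into terms controlled by the linear part, the
   Lipschitz continuity of grad N, the DEIM error delta, and the Lipschitz
   continuity of the Jacobian of h, giving
     (e, e') <= beta |e|^2 + (alpha |rho| + |v| delta) |e|.
   If g solves g' = 2 beta g + 2, g > 0, Young's inequality turns this into
     (|e|^2 / g)' <= alpha^2 |rho|^2 + |v|^2 delta^2;
   taking g = growth_const + eps * exp and letting eps tend to 0 bounds |e(t)|^2
   by growth_const times the integral of the right-hand side. *)
Require Import Defs.
From mathcomp Require Import all_boot all_order all_algebra.
From mathcomp Require Import all_classical all_reals all_analysis.
From mathcomp Require Import measurable_realfun ring lra.

Set Implicit Arguments.
Unset Strict Implicit.
Unset Printing Implicit Defensive.

Import Order.TTheory GRing.Theory Num.Theory.
Import numFieldNormedType.Exports.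

Local Open Scope classical_set_scope.
Local Open Scope ring_scope.

(** * Euclidean norms and the induced matrix norms *)

Section euclidean.
Variable R : realType.

Section dotp_theory.
Variable n : nat.
Implicit Types x y w : 'cV[R]_n.

Lemma dotpE x y : dotp x y = \sum_i x i 0 * y i 0.
Proof. by rewrite /dotp mxE; apply: eq_bigr => i _; rewrite mxE. Qed.

Lemma dotpC x y : dotp x y = dotp y x.
Proof. by rewrite !dotpE; apply: eq_bigr => i _; rewrite mulrC. Qed.

Lemma dotpDr x y w : dotp x (y + w) = dotp x y + dotp x w.
Proof. by rewrite /dotp mulmxDr mxE. Qed.

Lemma dotpNr x y : dotp x (- y) = - dotp x y.
Proof. by rewrite /dotp mulmxN mxE. Qed.

Lemma dotpZr a x y : dotp x (a *: y) = a * dotp x y.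
Proof. by rewrite /dotp -scalemxAr mxE. Qed.

Lemma dotp0r x : dotp x 0 = 0.
Proof. by rewrite /dotp mulmx0 mxE. Qed.

Lemma dotpDl x y w : dotp (x + y) w = dotp x w + dotp y w.
Proof. by rewrite dotpC dotpDr !(dotpC w). Qed.

Lemma dotpZl a x y : dotp (a *: x) y = a * dotp x y.
Proof. by rewrite dotpC dotpZr dotpC. Qed.

Lemma dotp_ge0 x : 0 <= dotp x x.
Proof. by rewrite dotpE sumr_ge0// => i _; rewrite -expr2 sqr_ge0. Qed.

Lemma dotp_eq0 x : dotp x x = 0 -> x = 0.
Proof.
rewrite dotpE => /psumr_eq0P x0; apply/colP => i; rewrite mxE.
apply/eqP; rewrite -(@sqrf_eq0 R); apply/eqP; rewrite expr2.
by apply: x0 => // j _; rewrite -expr2 sqr_ge0.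
Qed.

Lemma norm2_ge0 x : 0 <= norm2 x.
Proof. exact: sqrtr_ge0. Qed.

Lemma sqr_norm2 x : norm2 x ^+ 2 = dotp x x.
Proof. by rewrite sqr_sqrtr// dotp_ge0. Qed.

Lemma norm2_0 : norm2 (0 : 'cV[R]_n) = 0.
Proof. by rewrite /norm2 dotp0r sqrtr0. Qed.

Lemma norm2_eq0 x : norm2 x = 0 -> x = 0.
Proof. by move=> x0; apply: dotp_eq0; rewrite -sqr_norm2 x0 expr0n. Qed.

Lemma norm2N x : norm2 (- x) = norm2 x.
Proof. by rewrite /norm2 dotpNr dotpC dotpNr opprK. Qed.

Lemma norm2Z a x : 0 <= a -> norm2 (a *: x) = a * norm2 x.
Proof.
move=> a0; rewrite /norm2 dotpZl dotpZr mulrA -expr2 sqrtrM ?sqr_ge0//.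
by rewrite sqrtr_sqr ger0_norm.
Qed.

(** Cauchy-Schwarz: with a = |x| and b = |y|, the square |b x - a y|^2 equals 2ab(ab - (x,y)). The
    factor 2ab has to be positive, so vanishing vectors are treated first. *)
Lemma dotp_le x y : dotp x y <= norm2 x * norm2 y.
Proof.
have [x0|x0] := eqVneq (norm2 x) 0.
  by rewrite (norm2_eq0 x0) dotpC dotp0r norm2_0 mul0r.
have [y0|y0] := eqVneq (norm2 y) 0.
  by rewrite (norm2_eq0 y0) dotp0r norm2_0 mulr0.
have := dotp_ge0 (norm2 y *: x - norm2 x *: y).
rewrite dotpDl !dotpDr -!scaleNr !dotpZl !dotpZr -!sqr_norm2 (dotpC y).
have a0 : 0 < norm2 x by rewrite lt_neqAle eq_sym x0 norm2_ge0.
have b0 : 0 < norm2 y by rewrite lt_neqAle eq_sym y0 norm2_ge0.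
set a := norm2 x in a0 *; set b := norm2 y in b0 *.
have -> : b * (b * a ^+ 2) + b * (- a * dotp x y) +
  (- a * (b * dotp x y) + - a * (- a * b ^+ 2)) =
  (2 * (a * b)) * (a * b - dotp x y) by ring.
by rewrite pmulr_rge0 ?mulr_gt0// subr_ge0.
Qed.

Lemma norm2D x y : norm2 (x + y) <= norm2 x + norm2 y.
Proof.
rewrite -(@ler_pXn2r _ 2)// ?nnegrE ?addr_ge0 ?norm2_ge0//.
rewrite sqr_norm2 dotpDl !dotpDr (dotpC y x) sqrrD !sqr_norm2.
have := dotp_le x y; lra.
Qed.

Lemma ler_norm2B x y : `|norm2 x - norm2 y| <= norm2 (x - y).
Proof.
rewrite ler_norml; have := norm2D (x - y) y; have := norm2D (y - x) x.
rewrite !subrK -(norm2N (y - x)) opprB; lra.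
Qed.

Lemma norm2_continuous : continuous (@norm2 R n).
Proof.
have dotp_cont : continuous (fun x : 'cV[R]_n => dotp x x).
  have -> : (fun x : 'cV[R]_n => dotp x x) = fun x => \sum_i x i 0 * x i 0.
    by apply/funext => x; rewrite dotpE.
  apply: continuous_big => [|i _ x]; first exact: add_continuous.
  by apply: (@cvgM _ _ (nbhs x) _ (fun M : 'cV_n => M i 0) (fun M => M i 0));
    exact: coord_continuous.
move=> x; apply: (@continuous_comp _ _ _ (fun x : 'cV[R]_n => dotp x x) Num.sqrt).
  exact: dotp_cont.
exact: sqrt_continuous.
Qed.

(** The topology on column vectors comes from the max norm while the bound is Euclidean; continuity
    of [norm2] links the two. *)
Lemma lipschitz2_continuous (C : R) (F : 'cV[R]_n -> R) :
  (forall x y, `|F x - F y| <= C * norm2 (x - y)) -> continuous F.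
Proof.
move=> FC x; apply/(@cvgrPdist_le _ _ _ (nbhs x)) => e e0.
(* [C] may be zero or negative, so a positive majorant of it is used as divisor. *)
have C0 : 0 < `|C| + 1 by rewrite ltr_wpDl.
pose g (u : 'cV[R]_n) := norm2 (x - u).
have /(_ x) : continuous g.
  move=> u; apply: (@continuous_comp _ _ _ (fun u : 'cV[R]_n => x - u) (@norm2 R n)).
    exact: (@continuousB _ _ _ (cst (x : 'cV[R]_n)) id u
      (@cst_continuous _ _ _ u) (fun _ => id)).
  exact: norm2_continuous.
have gx : g x = 0 by rewrite /g subrr norm2_0.
move=> /(@cvgrPdist_le _ _ _ (nbhs x)) /(_ (e / (`|C| + 1)) (divr_gt0 e0 C0)).
rewrite gx.
apply: filterS => u; rewrite sub0r normrN ger0_norm ?norm2_ge0// ler_pdivlMr// => ue.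
apply: le_trans (FC _ _) (le_trans _ ue).
rewrite mulrC ler_wpM2l ?norm2_ge0//.
by rewrite (le_trans (ler_norm _))// lerDl.
Qed.

End dotp_theory.

Lemma dotp_mulmxl m n (M : 'M[R]_(m, n)) x y :
  dotp (M *m x) y = dotp x (M^T *m y).
Proof. by rewrite /dotp trmx_mul mulmxA. Qed.

Lemma dotp_mulmxr m n (M : 'M[R]_(m, n)) x y :
  dotp x (M *m y) = dotp (M^T *m x) y.
Proof. by rewrite dotp_mulmxl trmxK. Qed.

Lemma norm2_mulmx_iso m n (M : 'M[R]_(m, n)) x :
  M^T *m M = 1%:M -> norm2 (M *m x) = norm2 x.
Proof. by move=> MM; rewrite /norm2 dotp_mulmxl mulmxA MM mul1mx. Qed.

Lemma sqr_norm2_orth_sum m n (A : 'M[R]_(m, n)) r e :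
  A^T *m A = 1%:M -> A^T *m r = 0 ->
  norm2 (r + A *m e) ^+ 2 = norm2 r ^+ 2 + norm2 e ^+ 2.
Proof.
move=> AA Ar; rewrite !sqr_norm2 dotpDl !dotpDr !dotp_mulmxl dotp_mulmxr Ar.
by rewrite mulmxA AA mul1mx dotp0r dotpC dotp0r addr0 add0r.
Qed.

(** * The spectral norm as an operator norm *)

Section specnorm_theory.
Variables m n : nat.
Implicit Types M N : 'M[R]_(m, n).

(** Cauchy-Schwarz on each row, the constant being the Frobenius norm. This finite bound is what
    makes the supremum in [specnorm] meaningful. *)
Lemma mulmx_bounded M :
  exists2 C : R, 0 <= C & forall x, norm2 (M *m x) <= C * norm2 x.
Proof.
pose C := \sum_i norm2 (row i M)^T ^+ 2.
have C0 : 0 <= C by rewrite sumr_ge0// => i _; exact: sqr_ge0.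
exists (Num.sqrt C); first exact: sqrtr_ge0.
move=> x; rewrite -(@ler_pXn2r _ 2)// ?nnegrE ?mulr_ge0 ?norm2_ge0 ?sqrtr_ge0//.
rewrite [leLHS]sqr_norm2 exprMn (sqr_sqrtr C0) dotpE mulr_suml ler_sum// => i _.
have -> : (M *m x) i 0 = dotp (row i M)^T x.
  by rewrite /dotp trmxK -row_mul [RHS]mxE.
rewrite -expr2 -exprMn -[leLHS]real_normK ?num_real//.
rewrite ler_pXn2r// ?nnegrE ?mulr_ge0 ?norm2_ge0//.
rewrite ler_norml dotp_le andbT lerNl -dotpNr.
by rewrite (le_trans (dotp_le _ _))// norm2N.
Qed.

Lemma specnorm_has_sup M :
  has_sup [set norm2 (M *m x) | x in [set x : 'cV[R]_n | norm2 x <= 1]].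
Proof.
split; first by exists (norm2 (M *m 0)), 0 => //=; rewrite norm2_0.
have [C C0 MC] := mulmx_bounded M; exists C => _ [x /= x1 <-].
by rewrite (le_trans (MC x))// ler_piMr.
Qed.

Lemma specnorm_ge0 M : 0 <= specnorm M.
Proof.
apply: (le_trans (norm2_ge0 (M *m 0))); apply: ub_le_sup.
  by case: (specnorm_has_sup M).
by exists 0 => //=; rewrite norm2_0.
Qed.

Lemma norm2_mulmx M x : norm2 (M *m x) <= specnorm M * norm2 x.
Proof.
have [x0|x0] := eqVneq (norm2 x) 0.
  by rewrite (norm2_eq0 x0) mulmx0 !norm2_0 mulr0.
have x_gt0 : 0 < norm2 x by rewrite lt_neqAle eq_sym x0 norm2_ge0.
(* Rescaled to unit length, [x] competes in the supremum. *)
rewrite -ler_pdivrMr// mulrC -norm2Z ?invr_ge0 ?norm2_ge0// scalemxAr.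
apply: ub_le_sup; first by case: (specnorm_has_sup M).
exists ((norm2 x)^-1 *: x) => //=.
by rewrite norm2Z ?invr_ge0 ?norm2_ge0// mulVf.
Qed.

Lemma specnorm_le M (C : R) : 0 <= C ->
  (forall x, norm2 (M *m x) <= C * norm2 x) -> specnorm M <= C.
Proof.
move=> C0 MC; apply: ge_sup; first by case: (specnorm_has_sup M).
by move=> _ [x /= x1 <-]; rewrite (le_trans (MC x))// ler_piMr.
Qed.

Lemma specnormD M N : specnorm (M + N) <= specnorm M + specnorm N.
Proof.
apply: specnorm_le => [|x]; first by rewrite addr_ge0 ?specnorm_ge0.
by rewrite mulmxDl mulrDl (le_trans (norm2D _ _))// lerD ?norm2_mulmx.
Qed.

Lemma specnormN M : specnorm (- M) = specnorm M.
Proof.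
by rewrite /specnorm; congr sup; apply/eq_imagel => x _; rewrite mulNmx norm2N.
Qed.

Lemma ler_specnormB M N : `|specnorm M - specnorm N| <= specnorm (M - N).
Proof.
rewrite ler_norml; have := specnormD (M - N) N; have := specnormD (N - M) M.
rewrite !subrK -(specnormN (N - M)) opprB; lra.
Qed.

Lemma dotp_mulmx_le M x y :
  dotp x (M *m y) <= specnorm M * norm2 y * norm2 x.
Proof.
by rewrite (le_trans (dotp_le _ _))// mulrC ler_wpM2r ?norm2_ge0// norm2_mulmx.
Qed.

(** Moving the transpose to the other factor gives the bound with the norm of [M] itself, without
    comparing the spectral norms of [M] and its transpose. *)
Lemma dotp_trmulmx_le M x y :
  dotp x (M^T *m y) <= specnorm M * norm2 y * norm2 x.
Proof.
rewrite dotp_mulmxr trmxK (le_trans (dotp_le _ _))// mulrAC.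
by rewrite ler_wpM2r ?norm2_ge0// norm2_mulmx.
Qed.

End specnorm_theory.

Lemma specnormM m n p (M : 'M[R]_(m, n)) (N : 'M[R]_(n, p)) :
  specnorm (M *m N) <= specnorm M * specnorm N.
Proof.
apply: specnorm_le => [|x]; first by rewrite mulr_ge0 ?specnorm_ge0.
rewrite -mulmxA (le_trans (norm2_mulmx _ _))// -mulrA.
by rewrite ler_wpM2l ?specnorm_ge0// norm2_mulmx.
Qed.

Lemma lognorm_le n (K : 'M[R]_n) x : dotp x (K *m x) <= lognorm K * dotp x x.
Proof.
have [->|x0] := eqVneq x 0; first by rewrite mulmx0 !dotp0r mulr0.
have xx : 0 < dotp x x.
  by rewrite lt_neqAle dotp_ge0 andbT eq_sym; apply: contra_neq x0 => /dotp_eq0.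
rewrite -ler_pdivrMr//; apply: ub_le_sup; last by exists x.
(* The Rayleigh quotients are bounded by the spectral norm, so their supremum is a true upper
   bound. *)
exists (specnorm K) => _ [y /= y0 <-].
have yy : 0 < dotp y y.
  by rewrite lt_neqAle dotp_ge0 andbT eq_sym; apply: contra_neq y0 => /dotp_eq0.
by rewrite ler_pdivrMr// -sqr_norm2 expr2 mulrA dotp_mulmx_le.
Qed.

Lemma lipschitz_constP m n (g : 'cV[R]_n -> 'cV[R]_m) x y : lipschitz2 g ->
  norm2 (g x - g y) <= lipschitz_const g * norm2 (x - y).
Proof.
move=> [C gC]; have [->|xy] := eqVneq x y; first by rewrite !subrr !norm2_0 mulr0.
have norm2_gt0 (u v : 'cV[R]_n) : u != v -> 0 < norm2 (u - v).
  rewrite -subr_eq0 => uv; rewrite lt_neqAle norm2_ge0 andbT eq_sym.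
  by apply: contra_neq uv; exact: norm2_eq0.
rewrite -ler_pdivrMr ?norm2_gt0//; apply: ub_le_sup; last by exists (x, y).
by exists C => _ [[u v] /= uv <-]; rewrite ler_pdivrMr ?norm2_gt0.
Qed.

End euclidean.

(** * A Gronwall inequality *)

Section growth.
Variable R : realType.
Implicit Types t b : R.

Lemma is_derive_expR_affine (t0 b t : R) :
  is_derive t 1 (fun s => expR (2 * b * (s - t0))) (2 * b * expR (2 * b * (t - t0))).
Proof.
have H : is_derive t 1 (fun s : R => 2 * b * (s - t0)) (2 * b).
  have -> : (fun s : R => 2 * b * (s - t0)) = (2 * b) \*: (id - cst t0) by apply/funext.
  by apply: is_derive_eq; rewrite subr0 /GRing.scale/= mulr1.
rewrite [X in is_derive _ _ _ X]mulrC.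
exact: (@is_derive1_comp R (@expR R) _ t _ _ (is_derive_expR _) H).
Qed.

(** As a function of the final time, both branches solve the same linear equation g' = 2 b g + 2,
    starting from 0 at [t0]. *)
Lemma is_derive_growth_const (t0 b t : R) :
  is_derive t 1 (fun s => growth_const t0 s b) (2 * b * growth_const t0 t b + 2).
Proof.
rewrite /growth_const; have [->|b0] := eqVneq b 0.
  have -> : (fun s : R => 2 * (s - t0)) = 2 \*: (id - cst t0) by apply/funext.
  by apply: is_derive_eq; rewrite subr0 /GRing.scale/= mulr1 mulr0 mul0r add0r.
have H := is_derive_expR_affine t0 b t.
set g := fun s => expR _ in H.
have -> : (fun s : R => b^-1 * (expR (2 * b * (s - t0)) - 1)) = b^-1 \*: (g - cst 1).
  by apply/funext.
apply: is_derive_eq; rewrite /GRing.scale/= subr0; field; exact: b0.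
Qed.

Lemma growth_const_ge0 (t0 b t : R) : t0 <= t -> 0 <= growth_const t0 t b.
Proof.
move=> t0t; rewrite /growth_const; have [b0|b0|_] := ltgtP b 0; last first.
- by rewrite mulr_ge0// subr_ge0.
- rewrite mulr_ge0 ?invr_ge0 ?(ltW b0)// subr_ge0 -expR0 ler_expR.
  by rewrite !mulr_ge0// ?subr_ge0// ltW.
- rewrite mulr_le0// ?invr_le0 ?(ltW b0)// subr_le0 -[leRHS]expR0 ler_expR.
  by rewrite mulr_le0_ge0 ?subr_ge0// mulr_ge0_le0// ltW.
Qed.

Lemma growth_const_le (t0 b s t : R) : t0 <= s -> s <= t ->
  growth_const t0 s b <= growth_const t0 t b.
Proof.
move=> t0s st; rewrite /growth_const; have [b0|b0|_] := ltgtP b 0; last first.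
- by rewrite ler_wpM2l// lerB.
- rewrite ler_wpM2l ?invr_ge0 ?(ltW b0)// lerB// ler_expR.
  by rewrite ler_wpM2l ?mulr_ge0 ?(ltW b0)// lerB.
- rewrite ler_wnM2l ?invr_le0 ?(ltW b0)// lerB// ler_expR.
  by rewrite ler_wnM2l ?mulr_ge0_le0 ?(ltW b0)// lerB.
Qed.

End growth.

(** The left-hand side is the derivative of e / g when e' = d and g' = 2 b g + 2. Inserting the
    bound on [d], the terms in [b] and in g^-2 cancel exactly and only [q] remains. *)
Lemma quotient_derive_le (R : realFieldType) (e g b q d : R) : 0 < g ->
  d <= 2 * b * e + 2 * g^-1 * e + g * q ->
  e * (- g ^- 2 * (2 * b * g + 2)) + g^-1 * d <= q.
Proof.
move=> g0; rewrite -(@ler_pM2l _ g^-1) ?invr_gt0// => d_le.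
rewrite (le_trans (lerD (lexx _) d_le))// le_eqVlt; apply/orP; left.
by apply/eqP; field; rewrite gt_eqF.
Qed.

(** The derivative bound is assumed for every positive weight [g], so that at each time the weight
    can be the current value of a positive solution of g' = 2 b g + 2; then E / g grows at rate at
    most [q]. *)
Lemma gronwall (R : realType) (t0 T b : R) (E q : R -> R) : t0 < T ->
  {within `[t0, T], continuous E} -> {within `[t0, T], continuous q} ->
  (forall t, 0 <= q t) -> E t0 = 0 ->
  (forall t, t0 < t < T -> exists2 dE, is_derive t 1 E dE &
    forall g, 0 < g -> dE <= 2 * b * E t + 2 * g^-1 * E t + g * q t) ->
  forall t, t0 <= t <= T ->
    E t <= growth_const t0 T b * \int[lebesgue_measure]_(s in `[t0, T]) q s.
Proof.
move=> t0T cE cq q0 E0 dE t /andP[t0t tT].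
pose B s := parameterized_integral lebesgue_measure t0 s q.
have intq : lebesgue_measure.-integrable `[t0, T] (EFin \o q).
  by apply: continuous_compact_integrable => //; exact: segment_compact.
have cB : {within `[t0, T], continuous B}.
  by apply: parameterized_integral_continuous => //; exact: ltW.
have dB s : t0 < s < T -> derivable B s 1 /\ derive1 B s = q s.
  move=> /andP[t0s sT]; apply: (@continuous_FTC1_closed _ _ _ _ T) => //.
  by have /continuous_within_itvP[//|+ _ _] := cq; apply; rewrite in_itv/= t0s.
have Bt0 : B t0 = 0 by rewrite /B /parameterized_integral set_itv1 Rintegral_set1.
have B_le : {in `[t0, T]%R &, {homo B : r s / r <= s}}.
  by apply: ger0_derive1_le_cc => // s; rewrite in_itv/= => /dB[// _ ->].
have BT : B t <= B T by rewrite B_le// in_itv/= ?t0t ?tT ?lexx ?(ltW t0T).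
have Bt : 0 <= B t by rewrite -Bt0 B_le// in_itv/= ?t0t ?tT ?lexx ?(ltW t0T).
(* Adding [eps * expR _] to the growth constant, which vanishes at [t0], makes
   it positive while preserving its equation [g' = 2 b g + 2]. *)
have Eeps eps : 0 < eps ->
    E t <= (growth_const t0 t b + eps * expR (2 * b * (t - t0))) * B t.
  move=> eps0; pose g s := growth_const t0 s b + eps * expR (2 * b * (s - t0)).
  have g_gt0 s : t0 <= s -> 0 < g s.
    by move=> t0s; rewrite ltr_wpDl ?growth_const_ge0// mulr_gt0// expR_gt0.
  have dg (s : R) : is_derive s 1 g (2 * b * g s + 2).
    have H1 := is_derive_growth_const t0 b s.
    have H2 := is_derive_expR_affine t0 b s.
    apply: (is_derive_eq (is_deriveD H1 (is_deriveZ eps H2))).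
    rewrite /g /GRing.scale/=; ring.
  have cgV : {within `[t0, T], continuous (fun s => (g s)^-1)}.
    apply: derivable_within_continuous => s; rewrite in_itv/= => /andP[t0s _].
    have gN0 : g s != 0 by rewrite gt_eqF// g_gt0.
    by have [] := is_deriveV gN0 (dg s).
  (* [D] vanishes at [t0] and is nonincreasing, which yields E <= g B. *)
  pose D s := E s * (g s)^-1 - B s.
  have dD (s : R) : t0 < s < T -> exists2 d, is_derive s 1 D d & d <= 0.
    move=> s_itv; have [dEs Es Hs] := dE s s_itv.
    have [dBs Bs] := dB s s_itv.
    have gs : 0 < g s by rewrite g_gt0// ltW//; case/andP: s_itv.
    have {dBs}Bs : is_derive s 1 B (q s).
      by apply: DeriveDef; [exact: dBs|rewrite -derive1E; exact: Bs].
    have gN0 : g s != 0 by rewrite gt_eqF.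
    have gV := is_deriveV gN0 (dg s).
    exists (E s *: (- (g s) ^- 2 *: (2 * b * g s + 2)) + (g s)^-1 *: dEs - q s).
      rewrite /D.
      have EV := is_deriveM Es gV.
      exact: (is_deriveB EV Bs).
    rewrite /GRing.scale/= subr_le0.
    exact: (quotient_derive_le gs (Hs _ gs)).
  have : D t <= D t0.
    apply: (@ler0_derive1_le_cc _ D t0 T) => //;
      rewrite ?in_itv/= ?t0t ?tT ?lexx ?(ltW t0T)//.
    - by move=> s; rewrite in_itv/= => /dD[d []].
    - by move=> s; rewrite in_itv/= => /dD[d [_ <-]]; rewrite derive1E.
    - move=> s; apply: cvgB; last exact: cB.
      apply: cvgM; first exact: cE.
      exact: cgV.
  rewrite /D E0 mul0r Bt0 subrr subr_le0 ler_pdivrMr ?g_gt0// mulrC.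
  by [].
(* Both factors are nonnegative and nondecreasing in time, so [t] may be replaced by [T]. *)
have gT : growth_const t0 t b * B t <= growth_const t0 T b * B T.
  by rewrite ler_pM ?growth_const_ge0 ?growth_const_le.
apply/ler_addgt0Pr => e e0.
(* The added 1 keeps [c] positive even if [B t] is 0. With eps = e / c, the perturbation of the
   growth constant contributes at most [e]. *)
pose c := expR (2 * b * (t - t0)) * B t + 1.
have c0 : 0 < c by rewrite ltr_wpDl ?mulr_ge0 ?expR_ge0.
apply: (le_trans (Eeps _ (divr_gt0 e0 c0))).
rewrite mulrDl lerD// -[leLHS]mulrA mulrAC ler_pdivrMr// ler_pM2l//.
by rewrite /c lerDl.
Qed.

(** * Gradients and derivatives along paths *)

Section gradients.
Variable R : realType.

(** [grad] records only the derivatives along basis vectors; linearity of the differential extends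
    them to every direction. *)
Lemma derive_dotp n (F : 'cV[R]_n -> R) x w : differentiable F x ->
  'D_w F x = dotp (grad F x) w.
Proof.
move=> dF; rewrite deriveE// {1}(_ : w = \sum_j w j 0 *: delta_mx j 0); last first.
  apply/colP => i; rewrite summxE (bigD1 i)//= !mxE !eqxx mulr1 big1 ?addr0// => j ji.
  by rewrite !mxE eq_sym (negbTE ji) mulr0.
rewrite linear_sum dotpE; apply: eq_bigr => j _.
by rewrite linearZ/= mxE deriveE// mulrC.
Qed.

Lemma grad_comp_mulmx n k (A : 'M[R]_(n, k)) (F : 'cV[R]_n -> R) z :
  differentiable F (A *m z) ->
  grad (fun w => F (A *m w)) z = A^T *m grad F (A *m z).
Proof.
move=> dF; apply/colP => j; rewrite mxE.
(* The difference quotients agree before the limit is taken, because [A] is linear. *)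
have -> : 'D_(delta_mx j 0) (fun w => F (A *m w)) z = 'D_(A *m delta_mx j 0) F (A *m z).
  rewrite /derive; apply: (f_equal (fun g : R -> R => lim (g @ 0^'))).
  apply/funext => t /=.
  by rewrite mulmxDr scalemxAr.
rewrite derive_dotp// -colE dotpE !mxE.
by apply: eq_bigr => i _; rewrite !mxE mulrC.
Qed.

Lemma is_derive_quadratic n (L : 'M[R]_n) (f : 'cV[R]_n) (G : R) x w : L^T = L ->
  is_derive x w (fun u => 2^-1 * (u^T *m L *m u) 0 0 + (u^T *m f) 0 0 + G)
    (dotp (L *m x + f) w).
Proof.
move=> symL; set Q := fun u => _.
suff cQ : h^-1 *: (Q (h *: w + x) - Q x) @[h --> 0^'] --> dotp (L *m x + f) w.
  by apply: DeriveDef; [apply/cvg_ex; exists (dotp (L *m x + f) w)|apply/cvg_lim].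
have QE u : Q u = 2^-1 * dotp u (L *m u) + dotp u f + G.
  by rewrite /Q /dotp mulmxA.
(* By symmetry of [L], the difference quotient is exactly (L x + f, w) + h c, whose limit at h = 0
   is immediate. *)
pose c := 2^-1 * dotp w (L *m w).
have : dotp (L *m x + f) w + h * c @[h --> 0^'] --> dotp (L *m x + f) w + 0 * c.
  apply: cvgD; first exact: cvg_cst.
  by apply: cvgMl; exact: nbhs_dnbhs.
rewrite mul0r addr0; apply: cvg_trans; apply: near_eq_cvg.
near=> h; have h0 : h != 0 by near: h; exact: nbhs_dnbhs_neq.
rewrite !QE /c /GRing.scale/=.
rewrite mulmxDr -scalemxAr !dotpDl !dotpDr !dotpZl !dotpZr.
have -> : dotp x (L *m w) = dotp (L *m x) w by rewrite dotp_mulmxl symL.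
rewrite (dotpC w (L *m x)) (dotpC w f); field; exact: h0.
Unshelve. all: by end_near. Qed.

Lemma grad_hamiltonian n (L : 'M[R]_(n + n)) f G (N : 'cV[R]_(n + n) -> R) x :
  L^T = L -> differentiable N x ->
  grad (hamiltonian L f G N) x = L *m x + f + grad N x.
Proof.
move=> symL dN; apply/colP => j; rewrite mxE.
have dQ := is_derive_quadratic f G x (delta_mx j 0) symL.
rewrite [LHS](deriveD _ (diff_derivable dN)); last by case: dQ.
rewrite (@derive_val _ _ _ _ _ _ _ dQ) [RHS]mxE; congr (_ + _); last by rewrite mxE.
rewrite dotpC /dotp trmx_delta -rowE mxE; congr fun_of_matrix; exact: ord1.
Qed.

Lemma differentiable_mxcoord n d (h : 'cV[R]_n -> 'cV[R]_d) x i :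
  differentiable h x -> differentiable (fun u => h u i 0) x.
Proof.
move=> dh; apply: (@differentiable_comp _ _ _ _ h (fun M : 'cV[R]_d => M i 0)) => //.
exact: differentiable_coord.
Qed.

Lemma differentiable_mulmx_row n d (M : 'rV[R]_d) (h : 'cV[R]_n -> 'cV[R]_d) x :
  differentiable h x -> differentiable (fun u => (M *m h u) 0 0) x.
Proof.
move=> dh; have -> : (fun u => (M *m h u) 0 0) = \sum_i (M 0 i \*: (fun u => h u i 0)).
  by apply/funext => u; rewrite mxE fct_sumE.
by apply: differentiable_sum => i; apply: differentiableZ; exact: differentiable_mxcoord.
Qed.

Lemma grad_mulmx_row n d (M : 'rV[R]_d) (h : 'cV[R]_n -> 'cV[R]_d) x :
  differentiable h x ->
  grad (fun u => (M *m h u) 0 0) x = (jac h x)^T *m M^T.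
Proof.
move=> dh; apply/colP => j; rewrite mxE.
have -> : (fun u => (M *m h u) 0 0) = \sum_i (M 0 i \*: (fun u => h u i 0)).
  by apply/funext => u; rewrite mxE fct_sumE.
have dhi i : derivable (fun u => h u i 0) x (delta_mx j 0).
  by apply: diff_derivable; exact: differentiable_mxcoord.
rewrite derive_sum => [|i]; last exact: derivableZ.
by rewrite mxE; apply: eq_bigr => i _; rewrite deriveZ// !mxE mulrC.
Qed.

End gradients.

(** * Derivatives of trajectories, coordinate by coordinate *)

Section paths.
Variable R : realType.

(** At an interior time a whole neighbourhood lies in the interval, so the relative derivative is an
    ordinary one. Passing to coordinates gives access to real-valued calculus. *)
Lemma is_derive_coord n (t0 T t : R) (u : R -> 'cV[R]_n) (u' : 'cV[R]_n) i : t0 < t < T ->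
  has_deriv_within `]t0, T] u t u' -> is_derive t 1 (fun s => u s i 0) (u' i 0).
Proof.
move=> /andP[t0t tT] du.
suff cu : h^-1 *: (u (h *: 1 + t) i 0 - u t i 0) @[h --> 0^'] --> u' i 0.
  by apply: DeriveDef; [apply/cvg_ex; exists (u' i 0)|apply/cvg_lim].
have {}du : (s - t)^-1 * (u s i 0 - u t i 0) @[s --> within `]t0, T] t^'] --> u' i 0.
  have := cvg_comp _ _ du (@coord_continuous _ _ _ i 0 u').
  by apply: cvg_trans; apply: near_eq_cvg; apply: nearW => s /=; rewrite !mxE.
apply/cvgrPdist_lt => e e0.
have /cvgrPdist_lt /(_ e e0) := du.
rewrite !near_withinE => {}du.
have {}du : \forall s \near t, s != t ->
    `|u' i 0 - (s - t)^-1 * (u s i 0 - u t i 0)| < e.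
  have : \forall s \near t, s \in `]t0, T[ by apply: near_in_itvoo; rewrite in_itv/= t0t.
  apply: filterS2 du => s du; rewrite in_itv/= => /andP[t0s sT] st.
  by apply: du => //; rewrite /= in_itv/= t0s ltW.
(* Change of variable s = t + h, from s near t to h near 0. *)
move: du; rewrite (near_shift 0); apply: filterS => h /= du h0.
rewrite /GRing.scale/= mulr1; move: du; rewrite subr0 addrK; apply.
by rewrite -subr_eq0 addrK.
Qed.

Lemma is_derive_mulmx m n (M : 'M[R]_(m, n)) (u : R -> 'cV[R]_n) (u' : 'cV[R]_n) (t : R) :
  (forall i, is_derive t 1 (fun s => u s i 0) (u' i 0)) ->
  forall i, is_derive t 1 (fun s => (M *m u s) i 0) ((M *m u') i 0).
Proof.
move=> du i.
have -> : (fun s => (M *m u s) i 0) = \sum_j (M i j \*: (fun s => u s j 0)).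
  by apply/funext => s; rewrite mxE fct_sumE.
by rewrite mxE; apply: is_derive_sum => j; exact: is_deriveZ.
Qed.

Lemma is_derive_dotp n (u : R -> 'cV[R]_n) (u' : 'cV[R]_n) (t : R) :
  (forall i, is_derive t 1 (fun s => u s i 0) (u' i 0)) ->
  is_derive t 1 (fun s => dotp (u s) (u s)) (2 * dotp (u t) u').
Proof.
move=> du.
have -> : (fun s => dotp (u s) (u s)) = \sum_j ((fun s => u s j 0) * (fun s => u s j 0)).
  by apply/funext => s; rewrite dotpE fct_sumE.
apply: (is_derive_eq (is_derive_sum (fun j => is_deriveM (du j) (du j)))).
rewrite dotpE mulr_sumr; apply: eq_bigr => j _.
by rewrite /GRing.scale/= mulr_natl mulr2n.
Qed.

End paths.

(** * The error equation *)

Section symplectic.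
Variable R : realType.

Lemma sympJ_mul_tr n : sympJ n *m (sympJ n)^T = 1%:M :> 'M[R]_(n + n).
Proof.
rewrite /sympJ tr_block_mx mulmx_block !trmx0 raddfN/= !trmx1 !mulmx0 !mul0mx.
by rewrite mulNmx mulmxN opprK !mulmx1 !addr0 !add0r -scalar_mx_block.
Qed.

(** The diagonal entries of the product are the squared lengths of the rows of [D]. *)
Lemma mulmx_tr_eq0 m n (D : 'M[R]_(m, n)) : D *m D^T = 0 -> D = 0.
Proof.
move=> DD; apply: trmx_inj; rewrite trmx0.
apply/matrixP => i j.
have : D^T *m delta_mx j 0 = 0 :> 'cV_n.
  by apply: dotp_eq0; rewrite dotp_mulmxl trmxK mulmxA DD mul0mx dotp0r.
by rewrite -colE => /colP/(_ i); rewrite !mxE.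
Qed.

(** For the difference D of the two sides, expanding D D^T gives I - I - I + I = 0, since the
    symplectic matrices are orthogonal and [A] has orthonormal columns. *)
Lemma symplectic_commute n k (A : 'M[R]_(n + n, k + k)) :
  A^T *m A = 1%:M -> A^T *m sympJ n *m A = sympJ k ->
  A^T *m sympJ n = sympJ k *m A^T.
Proof.
move=> AA AJA; apply/eqP; rewrite -subr_eq0; apply/eqP/mulmx_tr_eq0.
rewrite linearB/= !trmx_mul !trmxK mulmxBl !mulmxBr.
rewrite !mulmxA AJA -(mulmxA _ (sympJ n)) sympJ_mul_tr mulmx1 AA.
have -> : sympJ k *m A^T *m (sympJ n)^T *m A = 1%:M.
  rewrite -!mulmxA [A^T *m (_ *m _)](_ : _ = (sympJ k)^T) ?sympJ_mul_tr//.
  by rewrite -AJA !trmx_mul trmxK.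
by rewrite -(mulmxA _ A^T) AA mulmx1 sympJ_mul_tr !subrr.
Qed.

(** The transpose of an isometry is a contraction: |M^T x|^2 = (x, M M^T x) <= |x| |M^T x|, then
    divide by |M^T x|. *)
Lemma norm2_trmx_le m n (M : 'M[R]_(m, n)) x : M^T *m M = 1%:M ->
  norm2 (M^T *m x) <= norm2 x.
Proof.
move=> MM; have [->|x0] := eqVneq (norm2 (M^T *m x)) 0; first exact: norm2_ge0.
have Mx_gt0 : 0 < norm2 (M^T *m x) by rewrite lt_neqAle eq_sym x0 norm2_ge0.
rewrite -(ler_pM2r Mx_gt0) -[leLHS]expr2 sqr_norm2 dotp_mulmxl trmxK.
by rewrite (le_trans (dotp_le _ _))// norm2_mulmx_iso.
Qed.

Lemma selection_mx_orthonormal d m (idx : 'I_m -> 'I_d) : injective idx ->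
  (selection_mx idx)^T *m selection_mx idx = 1%:M :> 'M[R]_m.
Proof.
move=> idxI; apply/matrixP => i j; rewrite !mxE (bigD1 (idx i))//= big1.
  by rewrite !mxE eqxx mul1r addr0 (inj_eq idxI).
by move=> l li; rewrite !mxE (negbTE li) mul0r.
Qed.

(** [U] acts as an isometry and the transpose of [S] as a contraction, so only the middle factor of
    the projection counts. This is where the constant in beta comes from. *)
Lemma specnorm_deim_proj d m (U S : 'M[R]_(d, m)) :
  U^T *m U = 1%:M -> S^T *m S = 1%:M ->
  specnorm (deim_proj U S) <= specnorm (invmx (S^T *m U)).
Proof.
move=> UU SS; apply: specnorm_le => [|x]; first exact: specnorm_ge0.
rewrite /deim_proj -!mulmxA norm2_mulmx_iso// (le_trans (norm2_mulmx _ _))//.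
by rewrite ler_wpM2l ?specnorm_ge0// norm2_trmx_le.
Qed.

End symplectic.

(** Full differentiability, beyond directional derivatives, is what the chain rule for [grad] asks
    for; the function is built from sums and products of coordinates. *)
Lemma differentiable_quadratic (R : realType) n (L : 'M[R]_n) (f : 'cV[R]_n) (G : R) x :
  differentiable (fun u : 'cV[R]_n => 2^-1 * (u^T *m L *m u) 0 0 + (u^T *m f) 0 0 + G) x.
Proof.
have dcoord i : differentiable (fun u : 'cV[R]_n => u i 0) x.
  exact: differentiable_coord.
have dlin (g : 'cV[R]_n) : differentiable (fun u : 'cV[R]_n => (u^T *m g) 0 0) x.
  have -> : (fun u : 'cV[R]_n => (u^T *m g) 0 0) =
      \sum_i (g i 0 \*: (fun u : 'cV[R]_n => u i 0)).
    apply/funext => u; rewrite mxE fct_sumE.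
    by apply: eq_bigr => i _; rewrite mxE mulrC.
  by apply: differentiable_sum => i; exact: differentiableZ.
pose lin (g u : 'cV[R]_n) : R := (u^T *m g) 0 0.
pose Q : 'cV[R]_n -> R := \sum_(j < n) (lin (col j L) * (fun u => u j 0)).
have -> : (fun u : 'cV[R]_n => 2^-1 * (u^T *m L *m u) 0 0 + (u^T *m f) 0 0 + G) =
    2^-1 \*: Q + lin f + cst G.
  apply/funext => u; rewrite !fctE mxE /Q fct_sumE; congr (_ * _ + _ + _).
  apply: eq_bigr => j _; rewrite !fctE /lin !mxE; congr (_ * _).
  by apply: eq_bigr => i _; rewrite !mxE.
apply: differentiableD; last exact: differentiable_cst.
apply: differentiableD; last exact: dlin.
apply: differentiableZ; apply: differentiable_sum => j.
by apply: differentiableM; [exact: dlin|exact: dcoord].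
Qed.

Lemma young_energy (R : realFieldType) (b s x p r : R) (g : R) : 0 < g ->
  s <= b * x ^+ 2 + (p + r) * x ->
  2 * s <= 2 * b * x ^+ 2 + 2 * g^-1 * x ^+ 2 + g * (p ^+ 2 + r ^+ 2).
Proof.
move=> g0 s_le.
(* Completed squares for Young's inequality 2 (p + r) x <= 2 x^2 / g + g (p^2 + r^2). *)
have : 0 <= g^-1 * ((2 * x - g * (p + r)) ^+ 2 + g ^+ 2 * (p - r) ^+ 2).
  by rewrite mulr_ge0 ?invr_ge0 ?(ltW g0)// addr_ge0 ?sqr_ge0// mulr_ge0// sqr_ge0.
have -> : g^-1 * ((2 * x - g * (p + r)) ^+ 2 + g ^+ 2 * (p - r) ^+ 2) =
    4 * (g^-1 * x ^+ 2) - 4 * ((p + r) * x) + 2 * (g * (p ^+ 2 + r ^+ 2)).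
  by field; rewrite gt_eqF.
nra.
Qed.

(** * Energy estimate for the reduced error *)

Section reduced_error.
Variables (R : realType) (n k d : nat).
Variables (L : 'M[R]_(n + n)) (f : 'cV[R]_(n + n)) (G : R).
Variables (N : 'cV[R]_(n + n) -> R) (A : 'M[R]_(n + n, k + k)).
Variables (v : 'cV[R]_d) (h : 'cV[R]_(n + n) -> 'cV[R]_d).
Variables (PP : 'M[R]_d) (c Lh : R).
Let H := hamiltonian L f G N.
Let Hhr := hyper_reduced_hamiltonian A L f G v PP h.
Let K := sympJ n *m L.
Let alpha := specnorm (A^T *m K) + lipschitz_const (grad N).
Let beta := lognorm K + Lh * c * norm2 v.
Let proj_err y := norm2 (y - A *m A^T *m y).
Let deim_err y := specnorm ((1%:M - PP) *m jac h (A *m A^T *m y) *m A).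

Hypothesis symL : L^T = L.
Hypothesis dH : forall x, differentiable H x.
Hypothesis lipH : lipschitz2 (grad H).
Hypothesis AA : A^T *m A = 1%:M.
Hypothesis AJA : A^T *m sympJ n *m A = sympJ k.
Hypothesis NE : forall w, N (A *m w) = (v^T *m h (A *m w)) 0 0.
Hypothesis dh : forall x, differentiable h x.
Hypothesis PPc : specnorm PP <= c.
Hypothesis lipJ : forall y1 y2,
  specnorm (jac h y1 - jac h y2) <= Lh * norm2 (y1 - y2).

Lemma nonlinear_differentiable x : differentiable N x.
Proof.
pose Q := fun u : 'cV[R]_(n + n) => 2^-1 * (u^T *m L *m u) 0 0 + (u^T *m f) 0 0 + G.
have -> : N = H - Q by apply/funext => u; rewrite !fctE /H /hamiltonian /Q addrC addKr.
by apply: differentiableB => //; exact: differentiable_quadratic.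
Qed.

Lemma gradH x : grad H x = L *m x + f + grad N x.
Proof. exact/grad_hamiltonian/nonlinear_differentiable. Qed.

Lemma nonlinear_lipschitz2 : lipschitz2 (grad N).
Proof.
have [C HC] := lipH; exists (C + specnorm L) => x y.
have -> : grad N x - grad N y = (grad H x - grad H y) - L *m (x - y).
  by rewrite !gradH mulmxBr; apply/colP => i; rewrite !mxE; ring.
rewrite (le_trans (norm2D _ _))// norm2N mulrDl lerD//.
exact: norm2_mulmx.
Qed.

Lemma gradHhr z : grad Hhr z =
  A^T *m (L *m (A *m z) + f + (jac h (A *m z))^T *m (PP^T *m v)).
Proof.
pose M := v^T *m PP.
(* The hyper-reduced Hamiltonian is a full one, with nonlinear part v^T PP h, restricted along [A];
   the chain rule then applies. *)
have -> : Hhr = fun w => hamiltonian L f G (fun u => (M *m h u) 0 0) (A *m w).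
  apply/funext => w; rewrite /Hhr /hyper_reduced_hamiltonian /hamiltonian.
  by rewrite trmx_mul !mulmxA.
have dM x := differentiable_mulmx_row M (@dh x).
rewrite (@grad_comp_mulmx _ _ _ A
  (hamiltonian L f G (fun u => (M *m h u) 0 0))); last first.
  by apply: differentiableD => //; exact: differentiable_quadratic.
rewrite grad_hamiltonian// grad_mulmx_row//.
by rewrite /M trmx_mul trmxK.
Qed.

(** The decomposition of [N] holds on the range of [A], so it identifies the gradients after
    multiplication by the transpose of [A]. *)
Lemma grad_nonlinear w : A^T *m grad N (A *m w) = A^T *m ((jac h (A *m w))^T *m v).
Proof.
rewrite -(@grad_comp_mulmx _ _ _ A N); last exact: nonlinear_differentiable.
have -> : (fun w => N (A *m w)) = fun w => (fun u => (v^T *m h u) 0 0) (A *m w).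
  by apply/funext => u; exact: NE.
rewrite (@grad_comp_mulmx _ _ _ A (fun u => (v^T *m h u) 0 0)); last first.
  exact: differentiable_mulmx_row.
by rewrite grad_mulmx_row// trmxK.
Qed.

Lemma reduced_error_derivative_le y z (e := A^T *m y - z) :
  dotp e (A^T *m (sympJ n *m grad H y) - sympJ k *m grad Hhr z) <=
  beta * norm2 e ^+ 2 + (alpha * proj_err y + norm2 v * deim_err y) * norm2 e.
Proof.
have AJ := symplectic_commute AA AJA.
set w := A *m A^T *m y; set r := y - w.
have eN x : norm2 (A *m ((sympJ k)^T *m x)) = norm2 x.
  rewrite norm2_mulmx_iso// norm2_mulmx_iso// trmxK; exact: sympJ_mul_tr.
have Ae : A *m e = w - A *m z by rewrite mulmxBr /w mulmxA.
(* Five contributions: the linear part on the projection error, the linear part on [A *m e], the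
   change of grad N from [y] to its projection [w], the DEIM error at [w], and the change of the
   Jacobian from [w] to [A *m z]. *)
have -> : A^T *m (sympJ n *m grad H y) - sympJ k *m grad Hhr z =
    A^T *m K *m r + A^T *m (K *m (A *m e)) +
    sympJ k *m (A^T *m (grad N y - grad N w)) +
    sympJ k *m (((1%:M - PP) *m jac h w *m A)^T *m v) +
    sympJ k *m (A^T *m ((jac h w - jac h (A *m z))^T *m (PP^T *m v))).
  have gw : A^T *m grad N w = A^T *m ((jac h w)^T *m v).
    by rewrite /w -mulmxA grad_nonlinear.
  have -> : ((1%:M - PP) *m jac h w *m A)^T *m v =
     A^T *m grad N w - A^T *m ((jac h w)^T *m (PP^T *m v)).
    rewrite gw -!mulmxBr !trmx_mul -!mulmxA; congr (_ *m (_ *m _)).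
    by rewrite linearB/= trmx1 mulmxBl mul1mx.
  rewrite [(jac h w - _)^T]linearB/= (mulmxBl (jac h w)^T) gradH gradHhr Ae /K /r.
  have AJx (x : 'cV_(n + n)) : A^T *m (sympJ n *m x) = sympJ k *m (A^T *m x).
    by rewrite !mulmxA AJ.
  rewrite -!(mulmxA A^T) -!(mulmxA (sympJ n)) !AJx !mulmxDr !mulmxN.
  (* Every term is now a value of the linear map [Q]; once these values are generalized, only an
     additive identity is left. *)
  pose Q (x : 'cV[R]_(n + n)) := sympJ k *m (A^T *m x).
  move: (Q (L *m y)) (Q (L *m w)) (Q (L *m (A *m z))) (Q f) (Q (grad N y))
    (Q (grad N w)) (Q ((jac h w)^T *m (PP^T *m v)))
    (Q ((jac h (A *m z))^T *m (PP^T *m v))) => x1 x2 x3 x4 x5 x6 x7 x8.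
  by apply/colP => i; rewrite !mxE; ring.
rewrite !dotpDr /alpha /beta.
have b1 : dotp e (A^T *m K *m r) <= specnorm (A^T *m K) * norm2 r * norm2 e.
  exact: dotp_mulmx_le.
have b2 : dotp e (A^T *m (K *m (A *m e))) <= lognorm K * norm2 e ^+ 2.
  rewrite dotp_mulmxr trmxK (le_trans (lognorm_le _ _))//.
  by rewrite -sqr_norm2 norm2_mulmx_iso.
(* Transferred onto [e], the operators preserve its length, so they cost no constant in the bounds
   below. *)
have skew x : dotp e (sympJ k *m (A^T *m x)) = dotp (A *m ((sympJ k)^T *m e)) x.
  by rewrite dotp_mulmxr dotp_mulmxr trmxK.
have b3 : dotp e (sympJ k *m (A^T *m (grad N y - grad N w))) <=
    lipschitz_const (grad N) * norm2 r * norm2 e.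
  rewrite skew (le_trans (dotp_le _ _))// eN mulrC ler_wpM2r ?norm2_ge0//.
  exact/lipschitz_constP/nonlinear_lipschitz2.
have b4 : dotp e (sympJ k *m (((1%:M - PP) *m jac h w *m A)^T *m v)) <=
    norm2 v * deim_err y * norm2 e.
  rewrite dotp_mulmxr (le_trans (dotp_trmulmx_le _ _ _))//.
  rewrite (norm2_mulmx_iso (M := (sympJ k)^T)) ?trmxK ?sympJ_mul_tr//.
  by rewrite (mulrC (norm2 v)).
(* The two base points are at distance |A e| = |e|, which supplies the second factor |e| and places
   this term in beta. *)
have b5 : dotp e (sympJ k *m (A^T *m ((jac h w - jac h (A *m z))^T *m (PP^T *m v)))) <=
    Lh * c * norm2 v * norm2 e ^+ 2.
  rewrite skew (mulmxA _ PP^T v) -trmx_mul (le_trans (dotp_trmulmx_le _ _ _))// eN.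
  rewrite expr2 mulrA ler_wpM2r ?norm2_ge0//.
  have -> : Lh * c * norm2 v * norm2 e = c * (Lh * norm2 e) * norm2 v by ring.
  rewrite ler_wpM2r ?norm2_ge0// (le_trans (specnormM _ _))//.
  rewrite ler_pM ?specnorm_ge0//.
  by rewrite (le_trans (lipJ _ _))// -Ae norm2_mulmx_iso.
rewrite -/r in b4 *; rewrite /proj_err -/w -/r.
apply: (le_trans (lerD (lerD (lerD (lerD b1 b2) b3) b4) b5)).
rewrite le_eqVlt; apply/orP; left; apply/eqP; ring.
Qed.

End reduced_error.

(** * Integration over time and parameters *)

Section within_continuity.
Variables (R : realType) (D : set R).

Lemma within_continuous_comp n (F : 'cV[R]_n -> R) (u : R -> 'cV[R]_n) :
  continuous F -> {within D, continuous u} -> {within D, continuous (fun s => F (u s))}.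
Proof. by move=> cF cu s; apply: continuous_comp; [exact: cu|exact: cF]. Qed.

Lemma within_continuous_coord n (u : R -> 'cV[R]_n) i :
  {within D, continuous u} -> {within D, continuous (fun s => u s i 0)}.
Proof.
apply: (@within_continuous_comp _ (fun M => M i 0)); exact: coord_continuous.
Qed.

Lemma within_continuous_sum n (F : 'I_n -> R -> R) :
  (forall i, {within D, continuous (F i)}) ->
  {within D, continuous (fun s => \sum_i F i s)}.
Proof.
move=> cF; apply: (@continuous_big R _ +%R 0 xpredT _ (subspace D)) => [|i _].
  exact: add_continuous.
exact: cF.
Qed.

Lemma within_continuousM (F1 F2 : R -> R) :
  {within D, continuous F1} -> {within D, continuous F2} ->
  {within D, continuous (fun s => F1 s * F2 s)}.
Proof. by move=> c1 c2 s; apply: cvgM; [exact: c1|exact: c2]. Qed.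

Lemma within_continuous_dotp_mulmxB m n (M : 'M[R]_(m, n)) (u : R -> 'cV[R]_n)
    (w : R -> 'cV[R]_m) :
  {within D, continuous u} -> {within D, continuous w} ->
  {within D, continuous (fun s => dotp (M *m u s - w s) (M *m u s - w s))}.
Proof.
move=> cu cw.
have -> : (fun s => dotp (M *m u s - w s) (M *m u s - w s)) =
    fun s => \sum_i (\sum_j M i j * u s j 0 - w s i 0) *
                    (\sum_j M i j * u s j 0 - w s i 0).
  by apply/funext => s; rewrite dotpE; apply: eq_bigr => i _; rewrite !mxE.
apply: within_continuous_sum => i.
have ci : {within D, continuous (fun s => \sum_j M i j * u s j 0 - w s i 0)}.
  move=> s; apply: cvgB; last exact: within_continuous_coord.
  apply: within_continuous_sum => j; apply: within_continuousM.
    by move=> r; exact: cvg_cst.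
  exact: within_continuous_coord.
exact: within_continuousM.
Qed.

End within_continuity.

(** The integral in the pointwise bound does not depend on [t], so integrating in time multiplies it
    by T - t0; the leading [pe t ^+ 2] accounts for the + 1. *)
Lemma integral_error_le (R : realType) (t0 T g a nu : R) (err2 pe de : R -> R) :
  t0 < T ->
  {within `[t0, T], continuous err2} -> {within `[t0, T], continuous pe} ->
  {within `[t0, T], continuous de} ->
  (forall t, t0 <= t <= T -> err2 t <= pe t ^+ 2 +
    g * \int[lebesgue_measure]_(s in `[t0, T]) ((a * pe s) ^+ 2 + (nu * de s) ^+ 2)) ->
  (\int[lebesgue_measure]_(t in `]t0, T]) (err2 t)%:E <=
    ((T - t0) * (g * a ^+ 2) + 1)%:E *
      \int[lebesgue_measure]_(t in `]t0, T]) (pe t ^+ 2)%:E +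
    ((T - t0) * nu ^+ 2 * g)%:E *
      \int[lebesgue_measure]_(t in `]t0, T]) (de t ^+ 2)%:E)%E.
Proof.
move=> t0T cerr cpe cde err_le.
have cX (F : R -> R) : {within `[t0, T], continuous F} ->
    {within `[t0, T], continuous (fun s => F s ^+ 2)}.
  by move=> cF; exact: within_continuousM.
have int F : {within `[t0, T], continuous F} ->
    lebesgue_measure.-integrable `[t0, T] (EFin \o F).
  by move=> cF; apply: continuous_compact_integrable => //; exact: segment_compact.
(* The endpoint [t0] is negligible, and continuity on the closed interval makes the integrals
   finite, so the estimate becomes one between real numbers. *)
have toR F : {within `[t0, T], continuous F} ->
    (\int[lebesgue_measure]_(t in `]t0, T]) (F t)%:E =
     (\int[lebesgue_measure]_(t in `[t0, T]) F t)%:E)%E.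
  move=> cF; rewrite integral_itv_obnd_cbnd; last first.
    apply: measurable_funS (measurable_int _ (int F cF)) => //.
    exact: subset_itv_oc_cc.
  by rewrite /Rintegral fineK//; apply: integrable_fin_num => //; exact: int.
rewrite (toR _ cerr) (toR _ (cX _ cpe)) (toR _ (cX _ cde)) -!EFinM -EFinD lee_fin.
move: err_le; under [X in g * X]eq_Rintegral do rewrite !exprMn.
set q := Rintegral _ _ _ => err_le.
have cZ (r : R) (F : R -> R) : {within `[t0, T], continuous F} ->
    {within `[t0, T], continuous (fun s => r * F s)}.
  by move=> cF; apply: within_continuousM => // s; exact: cvg_cst.
have ccst (r : R) : {within `[t0, T], continuous (fun=> r)}.
  by move=> s; exact: cvg_cst.
have qE : q = a ^+ 2 * \int[lebesgue_measure]_(t in `[t0, T]) (pe t ^+ 2) +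
    nu ^+ 2 * \int[lebesgue_measure]_(t in `[t0, T]) (de t ^+ 2).
  rewrite /q RintegralD//;
    [|exact: (int _ (cZ _ _ (cX _ cpe)))|exact: (int _ (cZ _ _ (cX _ cde)))].
  by rewrite !RintegralZl//; apply: int; exact: cX.
have qT : \int[lebesgue_measure]_(t in `[t0, T]) (pe t ^+ 2 + g * q) =
    \int[lebesgue_measure]_(t in `[t0, T]) (pe t ^+ 2) + g * q * (T - t0).
  rewrite RintegralD//; [|exact: (int _ (cX _ cpe))|exact: (int _ (ccst _))].
  congr (_ + _); rewrite Rintegral_cst//; congr (_ * _).
  by have := @lebesgue_measure_itv R `[t0, T]; rewrite /= lte_fin t0T => ->.
apply: (@le_trans _ _ (\int[lebesgue_measure]_(t in `[t0, T]) (pe t ^+ 2 + g * q))).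
  apply: le_Rintegral => //; first exact: int.
  by apply: int => s; apply: cvgD; [exact: (cX _ cpe)|exact: ccst].
rewrite qT qE.
rewrite le_eqVlt; apply/orP; left; apply/eqP; ring.
Qed.

(** * Error bound for a fixed parameter *)

Section reduced_error_bound.
Variables (R : realType) (n k d : nat) (t0 T : R).
Variables (L : 'M[R]_(n + n)) (f : 'cV[R]_(n + n)) (G : R).
Variables (N : 'cV[R]_(n + n) -> R) (A : 'M[R]_(n + n, k + k)).
Variables (v : 'cV[R]_d) (h : 'cV[R]_(n + n) -> 'cV[R]_d).
Variables (PP : 'M[R]_d) (c Lh : R).
Variables (y0 : 'cV[R]_(n + n)) (y : R -> 'cV[R]_(n + n)) (z : R -> 'cV[R]_(k + k)).
Let H := hamiltonian L f G N.
Let Hhr := hyper_reduced_hamiltonian A L f G v PP h.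
Let K := sympJ n *m L.
Let alpha := specnorm (A^T *m K) + lipschitz_const (grad N).
Let beta := lognorm K + Lh * c * norm2 v.
Let proj_err y := norm2 (y - A *m A^T *m y).
Let deim_err y := specnorm ((1%:M - PP) *m jac h (A *m A^T *m y) *m A).

Hypothesis t0T : t0 < T.
Hypothesis symL : L^T = L.
Hypothesis dH : forall x, differentiable H x.
Hypothesis lipH : lipschitz2 (grad H).
Hypothesis AA : A^T *m A = 1%:M.
Hypothesis AJA : A^T *m sympJ n *m A = sympJ k.
Hypothesis NE : forall w, N (A *m w) = (v^T *m h (A *m w)) 0 0.
Hypothesis dh : forall x, differentiable h x.
Hypothesis PPc : specnorm PP <= c.
Hypothesis lipJ : forall y1 y2,
  specnorm (jac h y1 - jac h y2) <= Lh * norm2 (y1 - y2).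
Hypothesis ivpy : solves_ivp t0 T (fun x => sympJ n *m grad H x) y0 y.
Hypothesis ivpz : solves_ivp t0 T (fun w => sympJ k *m grad Hhr w) (A^T *m y0) z.

Lemma proj_err_continuous : continuous proj_err.
Proof.
apply: (@lipschitz2_continuous _ _ (specnorm (1%:M - A *m A^T))) => x w.
rewrite (le_trans (ler_norm2B _ _))//.
rewrite -[x - _ - _](_ : (1%:M - A *m A^T) *m (x - w) = _).
  exact: norm2_mulmx.
by rewrite mulmxBr !mulmxBl !mul1mx.
Qed.

Lemma deim_err_continuous : continuous deim_err.
Proof.
(* One factor per map of the composition; the absolute value is there because the sign of [Lh] is
   not prescribed. *)
apply: (@lipschitz2_continuous _ _
  (specnorm (1%:M - PP) * (`|Lh| * specnorm (A *m A^T)) * specnorm A)) => x w.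
rewrite (le_trans (ler_specnormB _ _))// -mulmxBl -mulmxBr.
rewrite (le_trans (specnormM _ _))// mulrAC ler_wpM2r ?specnorm_ge0//.
rewrite (le_trans (specnormM _ _))// -mulrA ler_wpM2l ?specnorm_ge0//.
rewrite (le_trans (lipJ _ _))// -mulmxBr -mulrA.
apply: (le_trans (ler_wpM2r (norm2_ge0 _) (ler_norm _))).
by rewrite ler_wpM2l// norm2_mulmx.
Qed.

(** Gronwall for |e|^2, which is 0 at [t0] because [z] starts at the projected initial value;
    Young's inequality provides the bound for every weight. *)
Lemma reduced_error_le t : t0 <= t <= T ->
  norm2 (A^T *m y t - z t) ^+ 2 <= growth_const t0 T beta *
    \int[lebesgue_measure]_(s in `[t0, T])
      ((alpha * proj_err (y s)) ^+ 2 + (norm2 v * deim_err (y s)) ^+ 2).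
Proof.
move=> tT; have [_ cy dy yt0] := ivpy; have [_ cz dz zt0] := ivpz.
rewrite sqr_norm2.
apply: (@gronwall _ t0 T beta
  (fun s => dotp (A^T *m y s - z s) (A^T *m y s - z s))
  (fun s => (alpha * proj_err (y s)) ^+ 2 + (norm2 v * deim_err (y s)) ^+ 2)) => //.
- exact: within_continuous_dotp_mulmxB.
- apply: (@within_continuous_comp _ _ _ (fun x =>
    (alpha * proj_err x) ^+ 2 + (norm2 v * deim_err x) ^+ 2)) => // x.
  have cX (a : R) (F : 'cV[R]_(n + n) -> R) : continuous F ->
      {for x, continuous (fun x => (a * F x) ^+ 2)}.
    by move=> cF; apply: (@cvgM _ _ (nbhs x)); apply: (@cvgM _ _ (nbhs x));
      [exact: cvg_cst|exact: cF|exact: cvg_cst|exact: cF].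
  apply: (@cvgD _ _ _ (nbhs x)); first exact: (cX _ _ proj_err_continuous).
  exact: (cX _ _ deim_err_continuous).
- by move=> s; rewrite addr_ge0 ?sqr_ge0.
- by rewrite yt0 zt0 subrr dotp0r.
move=> s /andP[t0s sT].
have sT' : t0 < s <= T by rewrite t0s ltW.
have sT'' : t0 < s < T by rewrite t0s.
pose e' := A^T *m (sympJ n *m grad H (y s)) - sympJ k *m grad Hhr (z s).
have de i : is_derive s 1 (fun r => (A^T *m y r - z r) i 0) (e' i 0).
  have -> : (fun r => (A^T *m y r - z r) i 0) =
      (fun r => (A^T *m y r) i 0) - (fun r => z r i 0).
    by apply/funext => r; rewrite !fctE !mxE.
  have -> : e' i 0 =
      (A^T *m (sympJ n *m grad H (y s))) i 0 - (sympJ k *m grad Hhr (z s)) i 0.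
    by rewrite /e' !mxE.
  apply: is_deriveB.
    by apply: is_derive_mulmx => j; exact: is_derive_coord (dy s sT').
  exact: is_derive_coord (dz s sT').
exists (2 * dotp (A^T *m y s - z s) e'); first exact: is_derive_dotp.
move=> g g0; rewrite -sqr_norm2; apply: young_energy => //.
exact: reduced_error_derivative_le.
Qed.

Lemma time_integrated_error_le :
  (\int[lebesgue_measure]_(t in `]t0, T]) (norm2 (y t - A *m z t) ^+ 2)%:E <=
    ((T - t0) * (growth_const t0 T beta * alpha ^+ 2) + 1)%:E *
      \int[lebesgue_measure]_(t in `]t0, T]) (proj_err (y t) ^+ 2)%:E +
    ((T - t0) * norm2 v ^+ 2 * growth_const t0 T beta)%:E *
      \int[lebesgue_measure]_(t in `]t0, T]) (deim_err (y t) ^+ 2)%:E)%E.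
Proof.
have [_ cy _ _] := ivpy; have [_ cz _ _] := ivpz.
apply: integral_error_le => //.
- have -> : (fun t => norm2 (y t - A *m z t) ^+ 2) =
      fun t => dotp (A *m z t - y t) (A *m z t - y t).
    by apply/funext => t; rewrite -sqr_norm2 -norm2N opprB.
  exact: within_continuous_dotp_mulmxB.
- exact: (within_continuous_comp proj_err_continuous).
- exact: (within_continuous_comp deim_err_continuous).
move=> t tT; apply: le_trans (lerD (lexx _) (reduced_error_le tT)).
rewrite /proj_err; set r := y t - A *m A^T *m y t.
(* Orthogonal splitting: [r] is annihilated by the transpose of [A], so Pythagoras applies. *)
have -> : y t - A *m z t = r + A *m (A^T *m y t - z t).
  by rewrite mulmxBr mulmxA /r addrA subrK.
have Ar : A^T *m r = 0 by rewrite mulmxBr !mulmxA AA mul1mx subrr.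
by rewrite sqr_norm2_orth_sum.
Qed.

End reduced_error_bound.

(** * Integration over the parameter set *)

Lemma compact_lebesgue_rV_measurable (R : realType) (p : nat) (P : set 'rV[R]_p) :
  compact P -> measurable (P : set (lebesgue_rV_type R p)).
Proof.
move=> cP; apply: caratheodory_measurable_mu_ext.
have cloP : closed P by apply: compact_closed => //; exact: norm_hausdorff.
rewrite -[P]setCK; apply: (@measurableC _ (borel_rV R p)).
by apply: sub_sigma_algebra; exact: closed_openC.
Qed.

Lemma sqr_L2norm (R : realType) (p : nat) (t0 T : R) (P : set 'rV[R]_p)
    (g : R -> 'rV[R]_p -> R) :
  (L2norm t0 T P g ^+ 2 = \int[lebesgue_rV R p]_(eta in P)
    \int[lebesgue_measure]_(t in `]t0, T]) ((g t eta) ^+ 2)%:E)%E.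
Proof.
rewrite /L2norm; set I := integral _ _ _.
have I0 : (0 <= I)%E.
  by apply: integral_ge0 => eta _; apply: integral_ge0 => t _; rewrite lee_fin sqr_ge0.
by rewrite poweR12_sqrt// sqr_sqrte.
Qed.

(** Nonnegativity makes the integral additive and homogeneous even for infinite values. *)
Lemma ge0_le_integral_comb (R : realType) d (X : measurableType d)
    (mu : {measure set X -> \bar R}) (D : set X) (a b c : X -> \bar R) (r s : R) :
  measurable D -> 0 <= r -> 0 <= s ->
  (forall x, 0 <= a x)%E -> (forall x, 0 <= b x)%E -> (forall x, 0 <= c x)%E ->
  measurable_fun D a -> measurable_fun D b -> measurable_fun D c ->
  (forall x, D x -> a x <= r%:E * b x + s%:E * c x)%E ->
  (\int[mu]_(x in D) a x <=
    r%:E * \int[mu]_(x in D) b x + s%:E * \int[mu]_(x in D) c x)%E.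
Proof.
move=> mD r0 s0 a0 b0 c0 ma mb mc abc.
rewrite -!ge0_integralZl_EFin// -ge0_integralD//; last 4 first.
- by move=> x _; rewrite mule_ge0.
- exact: measurable_funeM.
- by move=> x _; rewrite mule_ge0.
- exact: measurable_funeM.
apply: ge0_le_integral => //.
by apply: emeasurable_funD; exact: measurable_funeM.
Qed.

Lemma sqr_L2norm_le_comb (R : realType) (p : nat) (t0 T : R) (P : set 'rV[R]_p)
    (g1 g2 g3 : R -> 'rV[R]_p -> R) (r s : R) :
  compact P -> 0 <= r -> 0 <= s ->
  L2_measurable t0 T P g1 -> L2_measurable t0 T P g2 -> L2_measurable t0 T P g3 ->
  (forall eta, P eta ->
    \int[lebesgue_measure]_(t in `]t0, T]) (g1 t eta ^+ 2)%:E <=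
    r%:E * \int[lebesgue_measure]_(t in `]t0, T]) (g2 t eta ^+ 2)%:E +
    s%:E * \int[lebesgue_measure]_(t in `]t0, T]) (g3 t eta ^+ 2)%:E)%E ->
  (L2norm t0 T P g1 ^+ 2 <=
    r%:E * L2norm t0 T P g2 ^+ 2 + s%:E * L2norm t0 T P g3 ^+ 2)%E.
Proof.
move=> cP r0 s0 [_ mg1] [_ mg2] [_ mg3] g123.
have int_ge0 (g : R -> 'rV[R]_p -> R) eta :
    (0 <= \int[lebesgue_measure]_(t in `]t0, T]) (g t eta ^+ 2)%:E)%E.
  by apply: integral_ge0 => t _; rewrite lee_fin sqr_ge0.
rewrite !sqr_L2norm.
apply: ge0_le_integral_comb => //.
exact: compact_lebesgue_rV_measurable.
Qed.

Theorem theorem3p3 (R : realType) (n k p d m : nat) (t0 T : R)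
    (P : set 'rV[R]_p)
    (L : 'rV[R]_p -> 'M[R]_(n + n)) (f : 'rV[R]_p -> 'cV[R]_(n + n))
    (G : 'rV[R]_p -> R) (N : 'cV[R]_(n + n) -> 'rV[R]_p -> R)
    (A : 'M[R]_(n + n, k + k))
    (v : 'cV[R]_d) (h : 'cV[R]_(n + n) -> 'rV[R]_p -> 'cV[R]_d)
    (U : 'M[R]_(d, m)) (idx : 'I_m -> 'I_d)
    (y0 : 'rV[R]_p -> 'cV[R]_(n + n))
    (y : R -> 'rV[R]_p -> 'cV[R]_(n + n)) (z : R -> 'rV[R]_p -> 'cV[R]_(k + k))
    (Lh : 'rV[R]_p -> R) :
  let H eta := hamiltonian (L eta) (f eta) (G eta) (N^~ eta) in
  let S : 'M[R]_(d, m) := selection_mx idx in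
  let PP := deim_proj U S in
  let Hhr eta :=
    hyper_reduced_hamiltonian A (L eta) (f eta) (G eta) v PP (h^~ eta) in
  let K eta := sympJ n *m L eta in
  let alpha eta :=
    specnorm (A^T *m K eta) + lipschitz_const (grad (N^~ eta)) in
  let beta eta :=
    lognorm (K eta) + Lh eta * specnorm (invmx (S^T *m U)) * norm2 v in
  let Ceta eta := growth_const t0 T (beta eta) in
  let DT := T - t0 in
  let C1 := DT * sup [set Ceta eta * alpha eta ^+ 2 | eta in P] + 1 in
  let C2 := DT * norm2 v ^+ 2 * sup [set Ceta eta | eta in P] in
  let err t eta := norm2 (y t eta - A *m z t eta) in
  let proj_err t eta := norm2 (y t eta - A *m A^T *m y t eta) in
  let deim_err t eta :=
    specnorm ((1%:M - PP) *m jac (h^~ eta) (A *m A^T *m y t eta) *m A) in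
  t0 < T ->
  compact P ->
  (forall eta, P eta ->
    (L eta)^T = L eta /\ forall x, 0 <= dotp x (L eta *m x)) ->
  (forall eta, P eta -> forall x, differentiable (H eta) x) ->
  (forall eta, P eta -> lipschitz2 (grad (H eta))) ->
  A^T *m A = 1%:M ->
  A^T *m sympJ n *m A = sympJ k ->
  (forall eta, P eta -> forall w : 'cV[R]_(k + k),
    N (A *m w) eta = (v^T *m h (A *m w) eta) 0 0) ->
  (forall eta, P eta -> forall x, differentiable (h^~ eta) x) ->
  U^T *m U = 1%:M ->
  injective idx ->
  S^T *m U \in unitmx ->
  (forall eta, P eta ->
    solves_ivp t0 T (fun x => sympJ n *m grad (H eta) x) (y0 eta) (y^~ eta)) ->
  (forall eta, P eta ->
    solves_ivp t0 T (fun w => sympJ k *m grad (Hhr eta) w) (A^T *m y0 eta)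
      (z^~ eta)) ->
  (forall eta, P eta -> forall y1 y2,
    specnorm (jac (h^~ eta) y1 - jac (h^~ eta) y2)
      <= Lh eta * norm2 (y1 - y2)) ->
  has_maximum [set Ceta eta * alpha eta ^+ 2 | eta in P] ->
  has_maximum [set Ceta eta | eta in P] ->
  L2_measurable t0 T P err ->
  L2_measurable t0 T P proj_err ->
  L2_measurable t0 T P deim_err ->
  (L2norm t0 T P err ^+ 2 <=
     C1%:E * L2norm t0 T P proj_err ^+ 2 +
     C2%:E * L2norm t0 T P deim_err ^+ 2)%E.
Proof.
move=> H S PP Hhr K alpha beta Ceta DT C1 C2 err proj_err deim_err.
move=> t0T cP symL dH lipH AA AJA NE dh UU idxI _ ivpy ivpz lipJ maxC1 maxC2.
move=> merr mproj mdeim.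
have SS : S^T *m S = 1%:M by exact: selection_mx_orthonormal.
have le_max (F : 'rV[R]_p -> R) eta : has_maximum [set F eta | eta in P] -> P eta ->
    F eta <= sup [set F eta | eta in P].
  by move=> [M _ PM] Peta; apply: ub_le_sup; [exists M|exists eta].
have Ceta0 eta : 0 <= Ceta eta by apply: growth_const_ge0; exact: ltW.
(* A maximum is attained at some parameter; its nonnegative value there shows that the constants are
   nonnegative. *)
have [eta0 Peta0] : P !=set0 by case: maxC2 => M [eta Peta _] _; exists eta.
have DT0 : 0 <= DT by rewrite subr_ge0 ltW.
have C10 : 0 <= C1.
  rewrite addr_ge0// mulr_ge0// (le_trans _ (le_max _ _ maxC1 Peta0))//.
  by rewrite mulr_ge0// sqr_ge0.
have C20 : 0 <= C2.
  have sup0 := le_trans (Ceta0 eta0) (le_max _ _ maxC2 Peta0).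
  exact: mulr_ge0 (mulr_ge0 DT0 (sqr_ge0 _)) sup0.
apply: sqr_L2norm_le_comb => //.
move=> eta Peta.
have [symLeta _] := symL _ Peta.
have := time_integrated_error_le t0T symLeta (dH _ Peta) (lipH _ Peta) AA AJA
  (NE _ Peta) (dh _ Peta) (specnorm_deim_proj UU SS) (lipJ _ Peta)
  (ivpy _ Peta) (ivpz _ Peta).
(* The constants for this [eta] are enlarged to the maxima over [P], the integrals they multiply
   being nonnegative. *)
move=> /le_trans; apply; apply: leeD; rewrite lee_wpmul2r ?lee_fin//.
- by apply: integral_ge0 => t _; rewrite lee_fin sqr_ge0.
- by rewrite lerD// ler_wpM2l// (le_max (fun eta => Ceta eta * alpha eta ^+ 2)).
- by apply: integral_ge0 => t _; rewrite lee_fin sqr_ge0.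
- exact: ler_wpM2l (mulr_ge0 DT0 (sqr_ge0 _)) _ _ (le_max Ceta _ maxC2 Peta).
Qed.
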